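(* Let $L$ be a completely distributive lattice which is upper well ordered, let $G$ be a group, and let $\mu\in L(G)$ be a non-trivial finitely generated $L$-group. Then $\mu$ has a maximal $L$-subgroup.
   Context: $L$ is a completely distributive lattice with least element $0$, and $G$ is a group with identity $e$. $L$ is upper well ordered if every non-empty subset of $L$ contains its supremum. An $L$-subset of $G$ is a function $G\to L$; $\eta\subseteq\mu$ means $\eta(x)\le\mu(x)$ for all $x\in G$. The tip and tail of $\mu$ are $\bigvee_{x\in G}\mu(x)$ and $\bigwedge_{x\in G}\mu(x)$. An $L$-subgroup of $G$ is an $L$-subset $\mu$ with $\mu(xy)\ge\mu(x)\wedge\mu(y)$ and $\mu(x^{-1})=\mu(x)$ for all $x,y\in G$; $L(G)$ is the set of these. For $\mu\in L(G)$, $L(\mu)$ is the set of $\eta\in L(G)$ with $\eta\subseteq\mu$ (the $L$-subgroups of $\mu$). If $\mu$ has tip $a_0$ and tail $t_0$, its trivial $L$-subgroup $\mu_{t_0}^{a_0}$ takes the value $a_0$ at $e$ and $t_0$ at every $x\neq e$; $\mu$ is non-trivial if $\mu\ne\mu_{t_0}^{a_0}$. For $a\in L$, $x\in G$, the $L$-point $a_x$ is the $L$-subset with value $a$ at $x$ and $0$ elsewhere; $a_x\in\mu$ means $\mu(x)\ge a$. $\mu$ is finitely generated if there are finitely many $L$-points ${a_1}_{x_1},\dots,{a_n}_{x_n}\in\mu$ such that $\mu$ is the smallest $L$-subgroup of $G$ containing their union (pointwise join). $\eta\in L(\mu)$ is proper if $\eta$ is non-constant and $\eta\ne\mu$. A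 proper $L$-subgroup $\eta$ of $\mu$ is a maximal $L$-subgroup of $\mu$ if, whenever $\eta\subseteq\theta\subseteq\mu$ with $\theta\in L(\mu)$, either $\theta=\eta$ or $\theta=\mu$. *)

(* Defs.v *)
From mathcomp Require Import all_boot all_order.
From mathcomp Require Import boolp classical_sets.

Set Implicit Arguments.
Unset Strict Implicit.
Unset Printing Implicit Defensive.

Local Open Scope classical_set_scope.
Local Open Scope order_scope.

Section CompleteLattices.
Context {d : Order.disp_t} {L : tbLatticeType d}.
Implicit Types A : set L.

(* These are genuine suprema and infima only when [L] is complete; the default
   values make [bigsup set0 = \bot] and [biginf set0 = \top]. *)
Definition bigsup A : L := supremum \bot A.
Definition biginf A : L := infimum \top A.

End CompleteLattices.

Section LatticePredicates.
Context (d : Order.disp_t) (L : tbLatticeType d).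

Definition complete_lattice : Prop :=
  forall A : set L, supremums A !=set0 /\ infimums A !=set0.

(* The meet over i of the joins of the J i is the join, over all choice
   functions f with f i in J i, of the meets of the f i. *)
Definition completely_distributive : Prop :=
  complete_lattice /\
  forall (I : Type) (J : I -> set L),
    biginf [set bigsup (J i) | i in [set: I]] =
    bigsup [set biginf [set f i | i in [set: I]] |
             f in [set f : I -> L | forall i, J i (f i)]].

Definition upper_well_ordered : Prop :=
  forall A : set L, A !=set0 -> A (bigsup A).

End LatticePredicates.

(* Inclusion of L-subsets is the library's pointwise order on [G -> L]. *)
Section LSubgroups.
Context {d : Order.disp_t} {L : tbLatticeType d} {G : groupType}.
Implicit Types mu eta theta : G -> L.

Definition tip mu : L := bigsup [set mu x | x in [set: G]].
Definition tail mu : L := biginf [set mu x | x in [set: G]].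

Definition Lsubgroup mu : Prop :=
  (forall x y : G, mu x `&` mu y <= mu (x * y)%g) /\
  (forall x : G, mu x^-1%g = mu x).

Definition Lsubgroup_of mu eta : Prop := Lsubgroup eta /\ eta <= mu.

Definition trivial_Lsubgroup mu : G -> L :=
  fun x => if x == 1%g then tip mu else tail mu.

Definition nontrivial mu : Prop := mu <> trivial_Lsubgroup mu.

Definition Lpoint (a : L) (x : G) : G -> L :=
  fun y => if y == x then a else \bot.

Definition Lpoint_in (a : L) (x : G) mu : Prop := a <= mu x.

Definition smallest_Lsubgroup_containing eta mu : Prop :=
  [/\ Lsubgroup mu, eta <= mu &
      forall theta, Lsubgroup theta -> eta <= theta -> mu <= theta].

Definition finitely_generated mu : Prop :=
  exists s : seq (L * G),
    (forall p, p \in s -> Lpoint_in p.1 p.2 mu) /\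
    smallest_Lsubgroup_containing
      (fun y => \join_(p <- s) Lpoint p.1 p.2 y) mu.

Definition constant_Lsubset mu : Prop := exists a : L, forall x, mu x = a.

Definition proper_Lsubgroup mu eta : Prop :=
  [/\ Lsubgroup_of mu eta, ~ constant_Lsubset eta & eta <> mu].

Definition maximal_Lsubgroup mu eta : Prop :=
  proper_Lsubgroup mu eta /\
  forall theta, Lsubgroup_of mu theta -> eta <= theta ->
    theta = eta \/ theta = mu.

End LSubgroups.

(* Main.v *)
Require Import Defs.
From mathcomp Require Import all_boot all_order.
From mathcomp Require Import boolp classical_sets.

(** As for maximal subgroups of a finitely generated group, Zorn's lemma is
    applied to the L-subgroups that lie between the trivial L-subgroup of [mu]
    and [mu] and differ from [mu] ([exists_maximal_above]).

    Starting from the trivial L-subgroup takes care of properness: an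
    L-subgroup above it has the value [tip mu] at the identity, so if it is
    constant, it is the top of its interval, namely [mu] itself
    ([proper_above_trivial]).

    A chain in this interval needs an upper bound different from [mu]. The
    join of the chain is the natural candidate; upper well ordering says that
    each value of this join is already a value of some member of the chain,
    which makes the join an L-subgroup ([Lsubgroup_chain_join]). The same
    attainment of values puts each of the finitely many generators of [mu] in
    a single member, should the join be [mu]; the largest of these members
    then contains all generators and is itself [mu], a contradiction
    ([chain_join_generated]). *)

Section MaximalLSubgroups.
Import Order.LTheory.
Local Open Scope classical_set_scope.
Local Open Scope order_scope.

Section Bounds.
Context {d : Order.disp_t} {L : tbLatticeType d}.
Hypothesis complL : complete_lattice L.
Implicit Type A : set L.

Lemma bigsup_ub A a : A a -> a <= bigsup A.
Proof.
move=> Aa; rewrite /bigsup /supremum ifF; last first.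
  by apply/negbTE/set0P; exists a.
by have [[s supAs] _] := complL A; have [/(_ a Aa)] := xgetI \bot supAs.
Qed.

Lemma bigsup_le A b : (forall a, A a -> a <= b) -> bigsup A <= b.
Proof.
move=> leAb; rewrite /bigsup /supremum; case: ifP => [_|_]; first exact: le0x.
have [[s supAs] _] := complL A.
by have [_ /(_ b leAb)] := xgetI \bot supAs.
Qed.

Lemma biginf_lb A a : A a -> biginf A <= a.
Proof.
move=> Aa; rewrite /biginf /infimum ifF; last first.
  by apply/negbTE/set0P; exists a.
by have [_ [s infAs]] := complL A; have [/(_ a Aa)] := xgetI \top infAs.
Qed.

End Bounds.

Section LSubgroupTheory.
Context {d : Order.disp_t} {L : tbLatticeType d} {G : groupType}.
Hypothesis complL : complete_lattice L.
Implicit Types (mu eta theta delta : G -> L) (C : set (G -> L)).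

Lemma Lsubgroup_le1 mu x : Lsubgroup mu -> mu x <= mu 1%g.
Proof.
by case=> muM muV; have := muM x x^-1%g; rewrite muV meetxx mulgV.
Qed.

Lemma le_tip mu x : mu x <= tip mu.
Proof. by apply: bigsup_ub => //; exists x. Qed.

Lemma tail_le mu x : tail mu <= mu x.
Proof. by apply: biginf_lb => //; exists x. Qed.

Lemma trivial_Lsubgroup_of mu :
  Lsubgroup mu -> Lsubgroup_of mu (trivial_Lsubgroup mu).
Proof.
move=> hmu; have le_tail_tip : tail mu <= tip mu.
  exact: le_trans (tail_le mu 1%g) (le_tip mu 1%g).
have tail_triv x : tail mu <= trivial_Lsubgroup mu x.
  by rewrite /trivial_Lsubgroup; case: ifP.
split; last first.
  apply/lefP => x; rewrite /trivial_Lsubgroup; case: eqP => [->|_].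
    by apply: bigsup_le => // _ [y _ <-]; exact: Lsubgroup_le1.
  exact: tail_le.
split=> [x y|x]; last by rewrite /trivial_Lsubgroup invg_eq1.
have [->|x1] := eqVneq x 1%g; first by rewrite mul1g leIr.
apply: le_trans (leIl _ _) _.
by rewrite {1}/trivial_Lsubgroup (negbTE x1).
Qed.

(** A constant L-subset above the trivial L-subgroup is at least [tip mu]
    everywhere, hence is above [mu]. *)
Lemma proper_above_trivial mu eta :
  Lsubgroup_of mu eta -> trivial_Lsubgroup mu <= eta -> eta <> mu ->
  proper_Lsubgroup mu eta.
Proof.
move=> eta_mu /lefP triv_eta neq; split=> // -[a eta_a]; apply: neq.
apply: le_anti; rewrite (proj2 eta_mu) /=; apply/lefP => x.
apply: le_trans (le_tip mu x) _.
by have := triv_eta 1%g; rewrite /trivial_Lsubgroup eqxx !eta_a.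
Qed.

Section Chains.
Hypothesis uwoL : upper_well_ordered L.

Definition chain_join C : G -> L :=
  fun x => bigsup [set eta x | eta in C].

Lemma le_chain_join C eta : C eta -> eta <= chain_join C.
Proof. by move=> Ceta; apply/lefP => x; apply: bigsup_ub => //; exists eta. Qed.

Lemma chain_join_attained C x :
  C !=set0 -> exists2 eta, C eta & eta x = chain_join C x.
Proof.
move=> [eta Ceta]; have [|theta] := uwoL [set eta x | eta in C].
  by exists (eta x), eta.
by exists theta.
Qed.

Definition chain C := total_on C (fun eta theta => eta <= theta).

Lemma chain_ub2 C eta theta : chain C -> C eta -> C theta ->
  exists2 rho, C rho & eta <= rho /\ theta <= rho.
Proof.
move=> Cch Ceta Ctheta; have [le|le] := Cch _ _ Ceta Ctheta.
  by exists theta.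
by exists eta.
Qed.

(** The values of the join at two points are attained in the chain, hence both
    below the values of a single member, which is closed under products. *)
Lemma Lsubgroup_chain_join C : C !=set0 -> chain C ->
  (forall eta, C eta -> Lsubgroup eta) -> Lsubgroup (chain_join C).
Proof.
move=> C0 Cch Csub; split=> [x y|x]; last first.
  congr bigsup; apply: eq_imagel => eta /Csub[_]; exact.
have [eta Ceta <-] := chain_join_attained _ x C0.
have [theta Ctheta <-] := chain_join_attained _ y C0.
have [rho Crho [/lefP le_eta /lefP le_theta]] :=
  chain_ub2 _ _ _ Cch Ceta Ctheta.
have [rhoM _] := Csub _ Crho.
apply: le_trans (leI2 (le_eta x) (le_theta y)) _.
by apply: le_trans (rhoM x y) _; move/lefP: (le_chain_join _ _ Crho); apply.
Qed.

Lemma chain_Lpoints C (s : seq (L * G)) : C !=set0 -> chain C ->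
  (forall p, p \in s -> Lpoint_in p.1 p.2 (chain_join C)) ->
  exists2 eta, C eta & forall p, p \in s -> Lpoint_in p.1 p.2 eta.
Proof.
move=> C0 Cch; elim: s => [_|p s IHs le_s].
  by have [eta Ceta] := C0; exists eta.
have [|eta Ceta eta_s] := IHs.
  by move=> q qs; apply: le_s; rewrite inE qs orbT.
have [theta Ctheta theta_p] := chain_join_attained _ p.2 C0.
have [rho Crho [/lefP le_eta /lefP le_theta]] :=
  chain_ub2 _ _ _ Cch Ceta Ctheta.
exists rho => // q; rewrite inE => /predU1P[->|/eta_s le_q].
  by apply: le_trans (le_theta _); rewrite theta_p; apply: le_s; exact: mem_head.
exact: le_trans le_q (le_eta _).
Qed.

(** Finite generation is a compactness property with respect to chains. *)
Lemma chain_join_generated C mu : finitely_generated mu ->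
  C !=set0 -> chain C -> (forall eta, C eta -> Lsubgroup eta) ->
  mu <= chain_join C -> exists2 eta, C eta & mu <= eta.
Proof.
move=> [s [s_mu [_ _ mu_min]]] C0 Cch Csub /lefP mu_C.
have [|eta Ceta eta_s] := chain_Lpoints _ s C0 Cch.
  by move=> p ps; exact: le_trans (s_mu p ps) (mu_C _).
exists eta => //; apply: mu_min; first exact: Csub.
apply/lefP => y; apply/joinsP_seq => p ps _; rewrite /Lpoint.
by case: eqP => [->|_]; [exact: eta_s|exact: le0x].
Qed.

Lemma exists_maximal_above mu delta : finitely_generated mu ->
  Lsubgroup_of mu delta -> delta <> mu ->
  exists eta, [/\ Lsubgroup_of mu eta, delta <= eta, eta <> mu &
    forall theta, Lsubgroup_of mu theta -> eta <= theta ->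
      theta = eta \/ theta = mu].
Proof.
move=> mu_fg delta_mu delta_neq.
pose P eta := [/\ Lsubgroup_of mu eta, delta <= eta & eta <> mu].
have Pdelta : P delta by split.
pose R (s t : {eta | P eta}) := sval s <= sval t.
have [|s t r||[eta [eta_mu delta_eta eta_neq]] etamax] :=
  @ZL_preorder _ (exist P delta Pdelta) R.
- by move=> s; exact: lexx.
- exact: le_trans.
- move=> A Atot; have [[s0 As0]|A0] := pselect (A !=set0); last first.
    (* The empty chain is bounded by the base point of the interval. *)
    by exists (exist P delta Pdelta) => s As; case: A0; exists s.
  pose C := [set sval s | s in A].
  have C0 : C !=set0 by exists (sval s0); exists s0.
  have Cch : chain C by move=> _ _ [s As <-] [t At <-]; exact: Atot.
  have CP eta : C eta -> P eta by case=> s _ <-; exact: svalP.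
  have Csub eta : C eta -> Lsubgroup eta by case/CP => -[].
  have PC : P (chain_join C).
    split.
    + split; first exact: Lsubgroup_chain_join.
      apply/lefP => x; apply: bigsup_le => // _ [eta /CP[[_ /lefP le_mu] _ _] <-].
      exact: le_mu.
    + have [_ le_delta _] := svalP s0.
      by apply: le_trans le_delta _; apply: le_chain_join; exists s0.
    + move=> C_mu; have [|eta Ceta mu_eta] :=
        chain_join_generated C mu mu_fg C0 Cch Csub; first by rewrite C_mu.
      have [[_ eta_mu] _ []] := CP _ Ceta.
      by apply: le_anti; rewrite eta_mu.
  by exists (exist P _ PC) => s As; apply: le_chain_join; exists s.
- exists eta; split=> // theta theta_mu le_theta.
  have [->|theta_neq] := pselect (theta = mu); [by right|left].
  have Ptheta : P theta by split=> //; exact: le_trans le_theta.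
  apply: le_anti; rewrite le_theta andbT.
  exact: (etamax (exist P theta Ptheta)).
Qed.

End Chains.
End LSubgroupTheory.
End MaximalLSubgroups.

Theorem theorem5p5 (d : Order.disp_t) (L : tbLatticeType d) (G : groupType)
    (hcd : completely_distributive L) (huwo : upper_well_ordered L)
    (mu : G -> L) (hmu : Lsubgroup mu)
    (hnt : nontrivial mu) (hfg : finitely_generated mu) :
  exists eta : G -> L, maximal_Lsubgroup mu eta.
Proof.
have [complL _] := hcd.
have triv_mu := trivial_Lsubgroup_of complL mu hmu.
have [|eta [eta_mu triv_eta eta_neq etamax]] :=
  exists_maximal_above complL huwo mu _ hfg triv_mu; first exact/nesym.
by exists eta; split; first exact: (proper_above_trivial complL).
Qed.
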